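(* Let $g$ be a fixed positive integer, and let $\{k_n\}_{n=1}^{\infty}$ be a sequence of positive integers such that $k_n \leq n$ for all $n$ and $$k_n = o\left(n^{g/(2g+2)}\right).$$ Then $$\lim_{n\rightarrow \infty} \frac{B_2[g](k_n,n)}{\binom{n}{k_n}} = 1.$$
   Context: For a nonempty set $A$ of positive integers and an integer $m$, let $r_{A,2}(m)$ denote the number of pairs $(a_1,a_2)$ with $a_1,a_2\in A$, $a_1\leq a_2$ and $a_1+a_2=m$. For a positive integer $g$, $A$ is called a $B_2[g]$-set if $r_{A,2}(m)\leq g$ for every integer $m$. For positive integers $g,k,n$, $B_2[g](k,n)$ denotes the number of $B_2[g]$-sets $A\subseteq\{1,\ldots,n\}$ with $|A|=k$. For sequences $u_n$ and $v_n>0$, $u_n=o(v_n)$ means $\lim_{n\to\infty}u_n/v_n=0$. *)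

(* Defs.v *)
From HB Require Import structures.
From mathcomp Require Import all_boot all_order all_algebra finmap.
From mathcomp Require Import all_classical all_reals all_analysis.

Set Implicit Arguments.
Unset Strict Implicit.
Unset Printing Implicit Defensive.

Import Order.TTheory GRing.Theory Num.Theory.
Import numFieldNormedType.Exports.

Local Open Scope fset_scope.

Definition rep2 (A : {fset nat}) (m : int) : nat :=
  #|` [fset p in A `*` A | (p.1 <= p.2)%N && (Posz (p.1 + p.2) == m)]|.

Definition B2set (g : nat) (A : {fset nat}) : Prop :=
  forall m : int, (rep2 A m <= g)%N.

(* [iota 1 n] lists 1, ..., n, so only sets of positive integers are counted. *)
Definition B2count (g k n : nat) : nat :=
  #|` [fset A in fpowerset [fset i in iota 1 n] |
        (#|` A| == k) && `[< B2set g A >]]|.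

(* Main.v *)
Require Import Defs.
From HB Require Import structures.
From mathcomp Require Import all_boot all_order all_algebra finmap.
From mathcomp Require Import all_classical all_reals all_analysis.
From mathcomp Require Import zify.

Import Order.TTheory GRing.Theory Num.Theory.
Import numFieldNormedType.Exports.

(** Call a [k]-subset of [{1, ..., n}] bad when it is not a [B_2[g]]-set.  The
    theorem is a first-moment estimate: the bad sets form a vanishing proportion
    of all [k]-subsets.

    A bad set [A] represents some [m <= 2n] as [a_1 + a_2], [a_1 <= a_2], in at
    least [g + 1] ways.  The set [T] of the smaller terms of [g + 1] of these
    representations satisfies [2t <= m] for every [t] in [T], and [A] contains
    [S = T U (m - T)] ([not_B2set_pairs]).  This set has [2g + 2] elements,
    unless [m = 2t] for some [t] in [T], in which case it has [2g + 1]
    ([card_pairs_union]).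

    A given set of size [s] lies in a proportion at most [(k/n)^s] of the
    [k]-subsets ([card_supersets_le]).  There are at most [n^(g+1)] choices of
    [T]; for each of them the [2n] values of [m] contribute a proportion at most
    [(k/n)^(2g+2)] each, and the at most [g + 1] degenerate values of [m] contribute
    at most [n (k/n)^(2g+2)] more each, since one factor [k/n] is lost and [k >= 1].
    Altogether the proportion of bad sets is at most
    [n^(g+1) * (2n + (g+1) n) * (k/n)^(2g+2) = (g + 3) * k^(2g+2) / n^g]
    ([card_not_B2set_le]), which is [g + 3] times the [(2g+2)]-th power of
    [k / n^(g/(2g+2))] and therefore tends to [0]. *)

Local Open Scope classical_set_scope.
Local Open Scope ring_scope.

(** * Counting subsets of a finite set *)

Section Counting.
Set Implicit Arguments.
Unset Strict Implicit.
Local Open Scope fset_scope.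
Local Open Scope nat_scope.

Lemma card_inj_image (T T' : choiceType) (f : T -> T') (A : {fset T}) :
  {in A &, injective f} -> #|` [fset f x | x in A]| = #|` A|.
Proof. by move=> f_inj; rewrite card_in_imfset. Qed.

(** Cleared of denominators, ['C(n - s, k - s) / 'C(n, k) <= (k / n) ^ s]: the
    left side is the product of the [(k - i) / (n - i)] for [i < s], and each
    factor is at most [k / n] because [k <= n]. *)
Lemma leq_exp_bin_sub (s k n : nat) : s <= k -> k <= n ->
  n ^ s * 'C(n - s, k - s) <= k ^ s * 'C(n, k).
Proof.
move=> + kn; elim: s => [|s IHs] sk; first by rewrite !expn0 !subn0.
apply: (@leq_trans (k * (n ^ s * 'C(n - s, k - s)))); last first.
  by rewrite expnS -mulnA leq_mul2l IHs ?orbT // ltnW.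
have ns_gt0 : 0 < n - s by lia.
rewrite expnS -mulnA -(leq_pmul2l ns_gt0).
have diag : (n - s) * 'C(n - s.+1, k - s.+1) = (k - s) * 'C(n - s, k - s).
  by rewrite !subnS mul_bin_diag prednK // subn_gt0.
have le_cross : n * (k - s) <= (n - s) * k by nia.
rewrite mulnCA (mulnCA (n - s) (n ^ s)) diag (mulnCA (n ^ s)) !mulnA.
by rewrite -!(mulnA _ (n ^ s)) leq_mul2r le_cross orbT.
Qed.

(** [fsub U] identifies the finite subsets of [U] with the sets over the finite
    type of elements of [U], for which the count is known. *)
Lemma card_ksubsets (K : choiceType) (U : {fset K}) (k : nat) :
  #|` [fset A in fpowerset U | #|` A| == k]| = 'C(#|` U|, k).
Proof.
rewrite [#|` U|]cardfE -card_draws -card_finset.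
rewrite -(@card_inj_image _ _ (fsub U)); last first.
  move=> A B; rewrite !inE !fpowersetE => /andP[AU _] /andP[BU _].
  exact: fsub_inj.
congr #|` _|; apply/fsetP => Y; apply/imfsetP/idP => /= [[A]|].
  rewrite !inE fpowersetE => /andP[AU /eqP Ak] ->.
  by rewrite card_fsub // Ak.
rewrite !inE => Yk; exists [fsetval y in Y]; last by rewrite FSetK.
have YU : [fsetval y in Y] `<=` U by apply/fsubsetP => y /in_fset_valP [].
by rewrite !inE fpowersetE YU /= -(card_fsub YU) FSetK.
Qed.

(** A random [k]-subset of [U] contains [S] with probability at most
    [(k / #|U|) ^ #|S|]: removing [S] sends the [k]-subsets that contain [S]
    injectively to the [(k - #|S|)]-subsets of the complement of [S]. *)
Lemma card_supersets_le (K : choiceType) (U S : {fset K}) (k : nat) :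
  k <= #|` U| ->
  #|` U| ^ #|` S| * #|` [fset A in fpowerset U | (#|` A| == k) && (S `<=` A)]|
    <= k ^ #|` S| * 'C(#|` U|, k).
Proof.
move=> kU; set X := [fset A in _ | _].
have [X0|[A0]] := fset_0Vmem X; first by rewrite X0 cardfs0 muln0.
rewrite !inE fpowersetE => /and3P[A0U /eqP A0k SA0].
have sk : #|` S| <= k by rewrite -A0k fsubset_leq_card.
apply: leq_trans (leq_exp_bin_sub sk kU); rewrite leq_mul2l; apply/orP; right.
rewrite -cardfsDS ?(fsubset_trans SA0) // -card_ksubsets.
rewrite -(@card_inj_image _ _ (fun A => A `\` S)); last first.
  move=> A B; rewrite !inE => /and3P[_ _ SA] /and3P[_ _ SB] AB.
  by rewrite -(fsetID S A) -(fsetID S B) AB (fsetIidPr SA) (fsetIidPr SB).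
apply: fsubset_leq_card; apply/fsubsetP => _ /imfsetP[A /= + ->].
rewrite !inE !fpowersetE => /and3P[AU /eqP <- SA].
by rewrite fsetSD // cardfsDS ?eqxx.
Qed.

Lemma card_union_bound (I : eqType) (K : choiceType) (r : seq I) (P : pred I)
    (B : {fset K}) (C : I -> {fset K}) :
  (forall x, x \in B -> exists2 i, (i \in r) && P i & x \in C i) ->
  #|` B| <= \sum_(i <- r | P i) #|` C i|.
Proof.
move=> BC; have {BC}: B `<=` \bigcup_(i <- r | P i) C i.
  by apply/fsubsetP => x /BC ?; apply/bigfcupP.
move=> /fsubset_leq_card /leq_trans; apply.
elim/big_rec2: _ => [|i m A _ IH]; first by rewrite cardfs0.
by rewrite (leq_trans (leq_card_fsetU _ _)) ?leq_add2l.
Qed.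

Lemma card_fset_iota (n : nat) : #|` [fset i in iota 1 n]| = n.
Proof. by rewrite card_fseq undup_id ?iota_uniq // size_iota. Qed.

Lemma bin_leq_exp (n k : nat) : 'C(n, k) <= n ^ k.
Proof.
elim: k n => [|k IHk] n; first by rewrite bin0.
apply: (@leq_trans (k.+1 * 'C(n, k.+1))); first exact: leq_pmull.
rewrite -mul_bin_diag expnS leq_mul2l (leq_trans (IHk _)) ?orbT //.
by case: k {IHk} => // k; rewrite leq_exp2r // leq_pred.
Qed.

Lemma sum_mem_le (s : seq nat) (D : {fset nat}) :
  uniq s -> \sum_(m <- s) (m \in D) <= #|` D|.
Proof.
move=> s_uniq; rewrite (eq_bigr (fun m => if m \in D then 1 else 0)); last first.
  by move=> m _; case: ifP.
rewrite -big_mkcond sum1_count -size_filter uniq_leq_size ?filter_uniq //.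
by move=> m; rewrite mem_filter => /andP[].
Qed.

(** * Sets with many representations of one integer *)

(** A family of representations of [m] is encoded by the set [T] of their smaller
    terms; this is the set of all the terms that occur in them. *)
Definition pairs_union (m : nat) (T : {fset nat}) : {fset nat} :=
  T `|` [fset m - t | t in T].

Lemma card_mirror (m : nat) (T : {fset nat}) :
  (forall t, t \in T -> t.*2 <= m) -> #|` [fset m - t | t in T]| = #|` T|.
Proof. by move=> Tm; apply: card_inj_image => t u /Tm ? /Tm ? ?; lia. Qed.

(** If [t] and [m - u] coincide, with [t] and [u] at most [m / 2], both equal
    [m / 2].  Hence [T] and its mirror image [m - T] share at most one element,
    and none unless [m] is twice an element of [T]. *)
Lemma card_pairs_union (m : nat) (T : {fset nat}) :
  (forall t, t \in T -> t.*2 <= m) ->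
  #|` T|.*2 <= #|` pairs_union m T| + (m \in [fset t.*2 | t in T]).
Proof.
move=> Tm; rewrite -addnn -{2}(card_mirror Tm) -cardfsUI leq_add2l.
have halves t : t \in T `&` [fset m - t | t in T] -> t.*2 = m /\ t \in T.
  rewrite inE => /andP[tT /imfsetP[u /= uT tE]]; split=> //.
  by have := Tm _ tT; have := Tm _ uT; lia.
case: (boolP (m \in _)) => [_|mNT] /=.
  rewrite -(cardfs1 m./2); apply: fsubset_leq_card; apply/fsubsetP => t.
  by move=> /halves[<- _]; rewrite inE doubleK.
rewrite leqn0 cardfs_eq0; apply/eqP/fsetP => t; rewrite in_fset0.
apply/negP => /halves[tm tT]; case/negP: mNT; apply/imfsetP.
by exists t.
Qed.

(** A representation of [m] is determined by its smaller term, so a set with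
    more than [g] representations of [m] yields [g + 1] smaller terms. *)
Lemma not_B2set_pairs (g n : nat) (A : {fset nat}) :
  A `<=` [fset i in iota 1 n] -> ~ B2set g A ->
  exists m T, [/\ m \in iota 1 n.*2, T `<=` A, #|` T| = g.+1,
    forall t, t \in T -> t.*2 <= m & pairs_union m T `<=` A].
Proof.
move=> An /existsNP[m /negP]; rewrite -ltnNge => g_lt.
pose X := [fset p in A `*` A | (p.1 <= p.2) && (Posz (p.1 + p.2) == m)].
have cardX : #|` X| = rep2 A m by [].
move: g_lt; rewrite -cardX => g_lt.
have [[a b] abX] : exists p : nat * nat, p \in X.
  by have [X0|[p pX]] := fset_0Vmem X; [rewrite X0 cardfs0 in g_lt|exists p].
have XP (p : nat * nat) : p \in X ->
    [/\ p.1 \in A, p.2 \in A, p.1 <= p.2 & Posz (p.1 + p.2) = m].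
  by rewrite !inE => /andP[/andP[? ?]] /andP[? /eqP].
have [/= aA bA _ mE] := XP _ abX.
have inn (x : nat) : x \in A -> 0 < x <= n.
  by move=> /(fsubsetP An); rewrite !inE mem_iota; lia.
set L := [fset p.1 | p in X].
have cardL : #|` L| = #|` X|.
  apply: card_inj_image => -[p1 p2] [q1 q2] /XP[/= _ _ _ pm] /XP[/= _ _ _ qm] pq.
  by have := etrans pm (esym qm); rewrite pq => -[/addnI ->].
have LX t : t \in L -> [/\ t \in A, a + b - t \in A & t.*2 <= a + b].
  move=> /imfsetP[p /= /XP[pA pA' pp pm] ->].
  rewrite (_ : a + b = p.1 + p.2); last by move: pm; rewrite -mE => -[->].
  by rewrite addKn -addnn leq_add2l.
pose T := [fset t in take g.+1 L].
have TL t : t \in T -> t \in L by rewrite inE => /mem_take.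
exists (a + b), T; split.
- rewrite mem_iota; move: (inn _ aA) (inn _ bA); clear; lia.
- by apply/fsubsetP => t /TL/LX[].
- by rewrite card_fseq undup_id ?take_uniq ?fset_uniq // size_takel // cardL.
- by move=> t /TL/LX[].
rewrite fsubUset; apply/andP; split; apply/fsubsetP => x; first by move=> /TL/LX[].
by move=> /imfsetP[t /= /TL/LX[? ? ?] ->].
Qed.

(** When [m] is twice an element of [T] the union of the pairs may have one
    element fewer, which costs a factor [#|U| / k <= #|U|]; bounding the cost by
    [1 + #|U|] gives both cases a common form that can be summed over [m]. *)
Lemma card_pairs_supersets_le (g k m : nat) (U T : {fset nat}) :
  0 < k -> k <= #|` U| -> #|` T| = g.+1 ->
  (forall t, t \in T -> t.*2 <= m) ->
  #|` U| ^ (2 * g + 2) *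
      #|` [fset A in fpowerset U | (#|` A| == k) && (pairs_union m T `<=` A)]|
    <= k ^ (2 * g + 2) * 'C(#|` U|, k)
         * (1 + #|` U| * (m \in [fset t.*2 | t in T])).
Proof.
move=> k_gt0 kU Tg Tm; have := card_pairs_union Tm; rewrite Tg.
have := card_supersets_le (pairs_union m T) kU.
set s := #|` pairs_union m T|; set N := #|` [fset A in _ | _]|.
set u := #|` U| in kU *; set C := 'C(u, k) => sN.
have s_le : s <= 2 * g + 2.
  rewrite (_ : 2 * g + 2 = #|` T| + #|` T|); last by rewrite Tg; lia.
  rewrite /s /pairs_union (leq_trans (leq_card_fsetU _ _)) // leq_add2l.
  by rewrite card_mirror.
case: (m \in _) => /= s_ge; last first.
  have -> : 2 * g + 2 = s by lia.
  by rewrite muln0 addn0 muln1.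
have [->|->] : 2 * g + 2 = s \/ 2 * g + 2 = s + 1 by lia.
  by rewrite (leq_trans sN) // leq_pmulr.
rewrite !expnD !expn1 mulnAC (leq_trans (leq_mul sN (leqnn u))) //.
by apply: leq_mul; [rewrite mulnAC leq_pmulr | rewrite muln1 add1n].
Qed.

(** * The proportion of sets that are not [B_2[g]]-sets *)

(** The union bound over all pairs [(m, T)] with [1 <= m <= 2n] and [T] a
    [(g + 1)]-subset.  Only the at most [g + 1] doubles of elements of [T] are
    degenerate values of [m], so that for each [T] the correction terms sum to
    at most [(g + 1) n], no more than a constant times the main term [2n]. *)
Lemma card_not_B2set_le (g k n : nat) : 0 < k <= n ->
  n ^ g * #|` [fset A in fpowerset [fset i in iota 1 n] |
                 (#|` A| == k) && ~~ `[< B2set g A >]]|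
    <= (g + 3) * k ^ (2 * g + 2) * 'C(n, k).
Proof.
move=> /andP[k_gt0 kn]; set U := [fset i in iota 1 n].
have cardU : #|` U| = n by exact: card_fset_iota.
set B := [fset A in _ | _].
set Ts := [fset T in fpowerset U | #|` T| == g.+1].
pose ok (i : nat * {fset nat}) := all (fun t => t.*2 <= i.1) i.2.
pose C (i : nat * {fset nat}) :=
  [fset A in fpowerset U | (#|` A| == k) && (pairs_union i.1 i.2 `<=` A)].
have B_le : #|` B| <=
    \sum_(i <- [seq (m, T) | m <- iota 1 n.*2, T <- enum_fset Ts] | ok i)
      #|` C i|.
  apply: card_union_bound => A; rewrite !inE fpowersetE => /and3P[AU Ak /asboolP].
  move=> /(not_B2set_pairs AU)[m [T [m_range TA Tg Tm TmA]]].
  exists (m, T); last by rewrite !inE fpowersetE AU Ak.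
  apply/andP; split; last by apply/allP.
  apply/allpairsP; exists (m, T); split=> //=.
  by rewrite !inE fpowersetE (fsubset_trans TA AU) Tg eqxx.
set K := k ^ (2 * g + 2) * 'C(n, k).
have C_le m T : T \in Ts ->
    (if ok (m, T) then n ^ (2 * g + 2) * #|` C (m, T)| else 0)
      <= K * (1 + n * (m \in [fset t.*2 | t in T])).
  rewrite !inE => /andP[_ /eqP Tg]; case: ifP => // /allP Tm.
  by have := @card_pairs_supersets_le g k m U T k_gt0; rewrite cardU; apply.
have n_gt0 : 0 < n by apply: leq_trans kn.
(* The bounds [C_le] carry the factor [n ^ (2 * g + 2)], hence the goal is
   multiplied by [n ^ (g + 2)], which is also the order of the number of pairs
   [(m, T)]. *)
have npow_gt0 : 0 < n ^ (g + 2) by rewrite expn_gt0 n_gt0.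
rewrite -(leq_pmul2l npow_gt0) mulnA -expnD (_ : g + 2 + g = 2 * g + 2); last by lia.
apply: (leq_trans (leq_mul (leqnn _) B_le)).
rewrite big_mkcond big_distrr big_allpairs exchange_big /=.
apply: (@leq_trans (\sum_(T <- Ts) K * ((g + 3) * n))).
  rewrite big_seq [leqRHS]big_seq; apply: leq_sum => T TTs.
  have Tg : #|` T| = g.+1 by move: TTs; rewrite !inE => /andP[_ /eqP].
  apply: (@leq_trans (\sum_(m <- iota 1 n.*2)
                        K * (1 + n * (m \in [fset t.*2 | t in T])))).
    apply: leq_sum => m _; apply: leq_trans (C_le m T TTs).
    by case: ifP => //; rewrite muln0.
  rewrite -big_distrr leq_mul2l big_split /= -big_distrr sum1_size size_iota /=.
  apply/orP; right.
  rewrite (_ : (g + 3) * n = n.*2 + n * g.+1); last by lia.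
  rewrite leq_add2l leq_mul2l (leq_trans (sum_mem_le _ (iota_uniq _ _))) ?orbT //.
  by rewrite -Tg card_inj_image // => t u _ _; apply: double_inj.
rewrite big_const_seq count_predT iter_addn_0 card_ksubsets cardU.
have := bin_leq_exp n g.+1; rewrite (_ : n ^ (g + 2) = n ^ g.+1 * n); last first.
  by rewrite addn2 expnS mulnC.
rewrite -/K; move=> bn.
apply: (leq_trans (leq_mul (leqnn _) bn)).
rewrite (_ : (g + 3) * _ * _ = (g + 3) * K); last by rewrite mulnA.
by apply: eq_leq; lia.
Qed.

Lemma B2count_add_not_B2set (g k n : nat) :
  B2count g k n + #|` [fset A in fpowerset [fset i in iota 1 n] |
                        (#|` A| == k) && ~~ `[< B2set g A >]]| = 'C(n, k).
Proof.
set U := [fset i in iota 1 n].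
have -> : 'C(n, k) = #|` [fset A in fpowerset U | #|` A| == k]|.
  by rewrite card_ksubsets card_fset_iota.
rewrite -[RHS](cardfsID [fset A in fpowerset U | `[< B2set g A >]]).
congr (_ + _); congr #|` _|; apply/fsetP => A; rewrite !inE.
  by case: (A \in _).
by case: (A \in _); case: (#|` A| == k); case: `[< _ >].
Qed.

End Counting.

(** * The limit *)

(** The [(2g+2)]-th power turns the exponent [g / (2g + 2)] into [g], so the
    subtracted term is exactly the bound [(g + 3) * k^(2g+2) / n^g] on the
    proportion of sets that are not [B_2[g]]-sets. *)
Lemma B2count_ratio_ge (R : realType) (g k n : nat) : (0 < k <= n)%N ->
  1 - (g + 3)%:R * (k%:R / n%:R `^ (g%:R / (2 * g + 2)%N%:R)) ^+ (2 * g + 2)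
    <= (B2count g k n)%:R / 'C(n, k)%:R :> R.
Proof.
move=> kn; have /andP[k_gt0 kn'] := kn.
have n_gt0 : 0 < n%:R :> R by rewrite ltr0n (leq_trans k_gt0).
have C_gt0 : 0 < 'C(n, k)%:R :> R by rewrite ltr0n bin_gt0.
have := card_not_B2set_le g kn; have := B2count_add_not_B2set g k n.
set bad := #|` _|; rewrite addnC => /esym CE bad_le.
have -> : (B2count g k n)%:R / 'C(n, k)%:R = 1 - bad%:R / 'C(n, k)%:R :> R.
  apply: (mulIf (lt0r_neq0 C_gt0)); rewrite mulrBl !divfK ?lt0r_neq0 // mul1r.
  by rewrite CE natrD addrAC subrr add0r.
rewrite lerD2l lerN2 expr_div_n -[(_ `^ _) ^+ _]powR_mulrn ?powR_ge0 // -powRrM divfK; last first.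
  by rewrite pnatr_eq0 addn2.
rewrite powR_mulrn ?ler0n // mulrA ler_pdivrMr // mulrAC ler_pdivlMr ?exprn_gt0 //.
by rewrite mulrC -!natrX -!natrM ler_nat.
Qed.

Theorem theorem2 (R : realType) (g : nat) (k : nat -> nat)
  (g_gt0 : (0 < g)%N)
  (k_bounds : forall n : nat, (0 < n)%N -> (0 < k n <= n)%N)
  (k_little_o :
    ((k n)%:R / (n%:R `^ (g%:R / (2 * g + 2)%N%:R)) : R) @[n --> \oo] --> (0 : R)) :
  ((B2count g (k n) n)%:R / 'C(n, k n)%:R : R) @[n --> \oo] --> (1 : R).
Proof.
apply: (squeeze_cvgr (f := fun n => 1 - (g + 3)%:R *
  ((k n)%:R / n%:R `^ (g%:R / (2 * g + 2)%N%:R)) ^+ (2 * g + 2)) (h := fun=> 1)).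
- near=> n.
  have kn : (0 < k n <= n)%N by apply: k_bounds; near: n; exact: nbhs_infty_gt.
  rewrite B2count_ratio_ge //= ler_pdivrMr ?ltr0n ?bin_gt0 ?(andP kn).2 //.
  by rewrite mul1r ler_nat -(B2count_add_not_B2set g) leq_addr.
- rewrite -[X in _ --> X]subr0; apply: cvgB; first exact: cvg_cst.
  rewrite -[X in _ --> X](mulr0 (g + 3)%:R); apply: cvgMr.
  have := cvg_comp _ _ k_little_o (@exprn_continuous _ (2 * g + 2) 0).
  by rewrite expr0n addn2.
- exact: cvg_cst.
Unshelve. all: by end_near. Qed.
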